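(* Fix real numbers $\alpha,\beta\ge0$ with $\alpha<\frac12$ and $\beta<\frac38$. Then there is no sequence of positive integers $n$ tending to infinity that admits, for each $n$ in the sequence, an arithmetic progression $A_n=\{b_n+ic_n:\ i\in\mathbb{Z},\ 0\le i<L_n\}\subset\mathbb{Z}_{>0}$ (with $b_n,c_n\in\mathbb{Z}$, $L_n\in\mathbb{Z}_{>0}$) having the $n$-divisor property and satisfying $$L_n\le n^{2\beta+o(1)},\qquad H_n\le\exp\bigl(n^{\alpha+o(1)}\bigr),$$ where $H_n=\max A_n$. In particular, for every sufficiently large $n$ there is no arithmetic progression $A=\{b+ic:\ i\in\mathbb{Z},\ 0\le i<L\}\subset\mathbb{Z}_{>0}$ (with $b,c\in\mathbb{Z}$, $L\in\mathbb{Z}_{>0}$) having the $n$-divisor property and satisfying $L\le n^{2\beta}$ and $\max A\le\exp(n^\alpha)$.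
   Context: For $n\in\mathbb{Z}_{>0}$, a finite set $A\subset\mathbb{Z}_{>0}$ has the $n$-divisor property if every $d\in\{1,\ldots,n\}$ divides at least one member of $A$. Each $o(1)$ denotes a real-valued quantity, depending on $n$, that tends to $0$ as $n\to\infty$ along the sequence (the two $o(1)$ terms may be different). *)

(* Defs.v *)
From HB Require Import structures.
From mathcomp Require Import all_boot all_order all_algebra.
From mathcomp Require Import finmap.
From mathcomp Require Import all_classical all_reals all_analysis.

Set Implicit Arguments.
Unset Strict Implicit.
Unset Printing Implicit Defensive.

Import Order.TTheory GRing.Theory Num.Theory.

Local Open Scope ring_scope.

Definition positive_fset (A : {fset int}) : Prop :=
  forall a : int, a \in A -> 0 < a.

Definition divisor_property (n : nat) (A : {fset int}) : Prop :=
  forall d : nat, (1 <= d <= n)%N -> exists2 a : int, a \in A & (d %| a)%Z.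

(* The common difference [c] may be zero or negative, so the progression can
   have fewer than [L] elements and [b] need not be its minimum. *)
Definition arith_prog (b c : int) (L : nat) : {fset int} :=
  [fset x in [seq (b + i%:Z * c)%R | i <- iota 0 L]]%fset.

(* The default value 0 makes this the maximum of [A] whenever [A] is a nonempty
   set of positive integers. *)
Definition fset_max (A : {fset int}) : int :=
  \big[Num.max/0]_(a <- A) a.

(* Main.v *)
Require Import Defs.
From HB Require Import structures.
From mathcomp Require Import all_boot all_order all_algebra.
From mathcomp Require Import finmap.
From mathcomp Require Import all_classical all_reals all_analysis.
From mathcomp Require Import zify ring lra.

(* Call a prime p <= sqrt n, slightly below sqrt n and not dividing c, a point,
   and an index i < L a line, with p on i when p divides b + i c.  Since
   p q <= n, any two points lie on a common line; since p q > L, two lines share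
   at most one point; and a point lies on at most r ~ L / sqrt n lines.  As
   log H is smaller than the number of primes up to sqrt n, no line contains all
   the points, so as in the de Bruijn-Erdos theorem there are at most r ^ 2
   points.  For L below n ^ (3/4) this is fewer than the n ^ (1/2 - o(1)) primes
   that Chebyshev's bound provides. *)

Set Implicit Arguments.
Unset Strict Implicit.
Unset Printing Implicit Defensive.

Import Order.TTheory GRing.Theory Num.Theory.
Import numFieldNormedType.Exports.

(** * An incidence bound of de Bruijn-Erdos type *)

(* A point [q] off the line [i] is joined to the points of [i] by distinct
   lines, so every line has at most [r] points; at most [r] lines cover the points
   joined to any fixed point. *)
Lemma linear_space_card_le (T I : finType) (inc : T -> I -> bool) (P : {set T})
    (r : nat) :
  {in P &, forall p q, exists i, inc p i && inc q i} ->
  (forall i j, i != j -> {in P &, forall p q, inc p i -> inc q i ->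
     inc p j -> inc q j -> p = q}) ->
  {in P, forall p, #|[set i | inc p i]| <= r} ->
  (forall i, exists2 p, p \in P & ~~ inc p i) ->
  #|P| <= r ^ 2.
Proof.
move=> joined meet thin proper.
have [->|[p0 Pp0]] := set_0Vmem P; first by rewrite cards0.
have line_le i : #|[set p in P | inc p i]| <= r.
  have [q Pq qNi] := proper i.
  (* Chooses a line joining [q] to each point; off [P] the value [i] is only a default. *)
  have pickP p : {j | p \in P -> inc q j && inc p j}.
    apply: cid; case: (boolP (p \in P)) => [Pp|]; last by exists i.
    by have [j hj] := joined q p Pq Pp; exists j.
  pose f p := sval (pickP p).
  have fP p : p \in P -> inc q (f p) && inc p (f p) by exact: (svalP (pickP p)).
  rewrite -(card_in_imset (f := f)) => [|p p'].
    apply: leq_trans (thin q Pq); apply: subset_leq_card.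
    by apply/fintype.subsetP => _ /imsetP[p /[!inE]/andP[/fP/andP[qf _] _] ->].
  rewrite !inE => /andP[Pp ip] /andP[Pp' ip'] ff.
  have /andP[qf pf] := fP p Pp; have /andP[_ pf'] := fP p' Pp'.
  apply: (meet i (f p)) => //; last by rewrite ff.
  by apply: contraNneq qNi => ->.
have sub : P \subset \bigcup_(i in [set i | inc p0 i]) [set p in P | inc p i].
  apply/fintype.subsetP => p Pp; have [i /andP[i0 ip]] := joined p0 p Pp0 Pp.
  by apply/finset.bigcupP; exists i; rewrite !inE ?Pp.
apply: leq_trans (subset_leq_card sub) _.
apply: (@leq_trans
  (\sum_(i in [set i | inc p0 i]) #|[set p in P | inc p i]|)).
  elim/big_rec2: _ => [|i m A _ IH]; first by rewrite cards0.
  by apply: leq_trans (leq_card_setU _ _) _; rewrite leq_add2l.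
apply: leq_trans (_ : \sum_(i in [set i | inc p0 i]) r <= _).
  by apply: leq_sum => i _.
by rewrite sum_nat_const expnS expn1 leq_mul2r thin ?orbT.
Qed.

(** * Prime divisors of an integer and Chebyshev's lower bound *)

Lemma expn2_size_primes m : 0 < m -> 2 ^ size (primes m) <= m.
Proof.
move=> m0; rewrite {2}(prod_prime_decomp m0) prime_decompE big_map /=.
rewrite -count_predT -sum1_count expn_sum big_seq [leqRHS]big_seq.
apply: leq_prod => p pm; move: (pm); rewrite mem_primes => /and3P[pp _ _].
rewrite expn1; apply: leq_trans (prime_gt1 pp) _.
by rewrite -{1}(expn1 p) leq_exp2l ?prime_gt1// logn_gt0.
Qed.

(** Bounds logarithmically both the number of points on a line and the number of primes dividing the
    common difference. *)
Lemma expn2_card_prime_divisors y (A : {set 'I_y}) m : 0 < m ->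
  {in A, forall p : 'I_y, prime p && (p %| m)} -> 2 ^ #|A| <= m.
Proof.
move=> m0 hA; apply: leq_trans (expn2_size_primes m0).
rewrite leq_exp2l// cardE -(size_map val); apply: uniq_leq_size.
  by rewrite (map_inj_uniq val_inj) enum_uniq.
move=> _ /mapP[p /[!mem_enum]/hA/andP[pp pm] ->].
by rewrite mem_primes pp m0 pm.
Qed.

(** By Legendre's formula the exponent is the sum over [k] of [m.*2 %/ p ^ k - (m %/ p ^ k).*2];
    each summand is at most 1 and vanishes once [p ^ k] exceeds [m.*2]. *)
Lemma logn_central_bin p m : prime p -> logn p 'C(m.*2, m) <= trunc_log p m.*2.
Proof.
move=> pp; have mm : m <= m.*2 by lia.
have := congr1 (logn p) (bin_fact mm).
have -> : m.*2 - m = m by lia.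
rewrite !lognM ?muln_gt0 ?fact_gt0 ?bin_gt0// !logn_fact//.
set t := trunc_log p m.*2 => E.
have H k : m.*2 %/ p ^ k <= (m %/ p ^ k).*2 + (k <= t).
  have [kt|tk] := leqP k t.
    by rewrite -!addnn -[(_ + _)%N in leqLHS]/(m + m); exact: leq_divDl.
  rewrite divn_small// ltnNge; apply/negP => /(trunc_log_max (prime_gt1 pp)).
  by rewrite leqNgt tk.
(* Since [p ^ k > k], the terms with [k > m] vanish, so Legendre's sum for [m] can share the range
   of the one for [m.*2]. *)
have Z a b : m <= a -> \sum_(a.+1 <= k < b) m %/ p ^ k = 0.
  move=> ma; apply: big1_seq => k /andP[_]; rewrite mem_index_iota => hk.
  rewrite divn_small//; apply: leq_ltn_trans (ltn_expl k (prime_gt1 pp)); lia.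
have S : \sum_(1 <= k < m.*2.+1) m %/ p ^ k = \sum_(1 <= k < m.+1) m %/ p ^ k.
  rewrite (@big_cat_nat _ _ _ m.+1)//=.
    by rewrite [X in _ + X]Z// addn0.
have : \sum_(1 <= k < m.*2.+1) m.*2 %/ p ^ k <=
  \sum_(1 <= k < m.*2.+1) ((m %/ p ^ k) + (m %/ p ^ k) + (k <= t)).
  by apply: leq_sum => k _; rewrite addnn.
rewrite !big_split /= S => h.
have : \sum_(1 <= k < m.*2.+1) (k <= t) <= t.
  rewrite -big_mkcond /= sum1_count -size_filter.
  rewrite -[leqRHS](size_iota 1); apply: uniq_leq_size.
    by rewrite filter_uniq// iota_uniq.
  by move=> k; rewrite mem_filter mem_index_iota mem_iota; lia.
lia.
Qed.

(** By Pascal's rule and symmetry, ['C(m.*2.+2, m.+1)] is twice ['C(m.*2.+1, m.+1)], which is at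
    least ['C(m.*2, m)]. *)
Lemma expn2_le_central_bin m : 2 ^ m <= 'C(m.*2, m).
Proof.
elim: m => // m IH; rewrite doubleS binS expnS mul2n -addnn.
have sym : 'C(m.*2.+1, m) = 'C(m.*2.+1, m.+1).
  by rewrite -bin_sub; [congr binomial|]; lia.
by rewrite sym leq_add// (leq_trans IH)// binS leq_addl.
Qed.

(** Chebyshev's argument: each prime power in the factorization of the central binomial coefficient
    is at most [m.*2 <= y], and only primes up to [y] occur. *)
Lemma expn2_le_expn_primes y m : 0 < m -> m.*2 <= y ->
  2 ^ m <= y ^ #|[set p : 'I_y.+1 | prime p]|.
Proof.
move=> m0 my; apply: leq_trans (expn2_le_central_bin m) _.
have C0 : 0 < 'C(m.*2, m) by rewrite bin_gt0; lia.
have bound p : p \in primes 'C(m.*2, m) -> p ^ logn p 'C(m.*2, m) <= y.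
  rewrite mem_primes => /and3P[pp _ _]; apply: leq_trans my.
  apply: leq_trans (trunc_logP (prime_gt1 pp) _); last by lia.
  by rewrite leq_exp2l ?prime_gt1// logn_central_bin.
rewrite {1}(prod_prime_decomp C0) prime_decompE big_map /=.
apply: (@leq_trans (\prod_(p <- primes 'C(m.*2, m)) y)).
  by rewrite big_seq [leqRHS]big_seq; apply: leq_prod.
rewrite big_const_seq count_predT iter_muln_1 leq_exp2l; last by lia.
rewrite cardE -(size_map val); apply: uniq_leq_size; first exact: primes_uniq.
move=> p pC; have py := bound p pC; move: pC.
rewrite mem_primes => /and3P[pp _ pC].
have lt_py : p < y.+1.
  rewrite ltnS (leq_trans _ py)// -{1}(expn1 p) leq_exp2l ?prime_gt1//.
  by rewrite logn_gt0 mem_primes pp C0.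
by apply/mapP; exists (Ordinal lt_py); rewrite // mem_enum inE.
Qed.

(** * The incidence structure of a progression *)

Local Open Scope ring_scope.

(* The points are the primes [w < p <= y] not dividing [c]; the primes dividing
   [c] divide every term, so there are at most [K] of them. *)
Lemma card_primes_le_of_divisor_progression (n y w r K L : nat) (b c : int) :
  (y * y <= n)%N -> (0 < L)%N -> (L <= w * w)%N -> (L <= r * w)%N ->
  (forall i, (i < L)%N ->
     0 < b + i%:Z * c /\ (absz (b + i%:Z * c)%R < 2 ^ K.+1)%N) ->
  (forall d, (1 <= d <= n)%N -> exists2 i, (i < L)%N & (d %| b + i%:Z * c)%Z) ->
  (#|[set p : 'I_y.+1 | prime p]| <= w + K.*2 + r ^ 2)%N.
Proof.
move=> yn L0 Lw2 Lrw small divs.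
pose B := [set p : 'I_y.+1 | prime p && (p %| c)%Z].
pose P := [set p : 'I_y.+1 | [&& prime p, (w < p)%N & ~~ (p %| c)%Z]].
have le_K (A : {set 'I_y.+1}) i : (i < L)%N ->
    {in A, forall p : 'I_y.+1, prime p && (p %| b + i%:Z * c)%Z} ->
    (#|A| <= K)%N.
  move=> iL hA; have [a0 aK] := small i iL.
  rewrite -ltnS -(ltn_exp2l _ _ (isT : 1 < 2)%N).
  apply: leq_ltn_trans aK; apply: expn2_card_prime_divisors => //.
  by rewrite absz_gt0 gt_eqF.
have le_n (p : 'I_y.+1) : (p <= n)%N.
  have yy : (y <= y * y)%N by case: (y) => // y'; apply: leq_pmulr.
  by apply: leq_trans yn; apply: leq_trans yy; rewrite -ltnS.
have BK : (#|B| <= K)%N.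
  apply: (le_K _ 0%N) => // p; rewrite inE => /andP[pp pc]; rewrite pp /=.
  have [|i iL] := divs p; first by rewrite prime_gt0 ?le_n.
  by rewrite mul0r addr0 rpredDr// dvdz_mull.
have split : (#|[set p : 'I_y.+1 | prime p]| <= #|P| + #|B| + w)%N.
  (* Zero is left out so that [W] has at most [w] elements, not [w + 1]. *)
  pose W := [set p : 'I_y.+1 | 0 < p <= w]%N.
  have Ww : (#|W| <= w)%N.
    rewrite cardE -(size_map val) -[leqRHS](size_iota 1).
    apply: uniq_leq_size; first by rewrite (map_inj_uniq val_inj) enum_uniq.
    move=> _ /mapP[p /[!mem_enum]/[!inE] hp ->]; by rewrite mem_iota add1n ltnS.
  have [+ _] := leq_card_setU P B; have [+ _] := leq_card_setU (P :|: B) W.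
  have : (#|[set p : 'I_y.+1 | prime p]| <= #|(P :|: B) :|: W|)%N.
    apply: subset_leq_card; apply/fintype.subsetP => p /[!inE] pp.
    by rewrite pp prime_gt0//= ltnNge; case: (p <= w)%N; case: (c \in _).
  lia.
(* With at most [K] points the bound [w + K + K] already suffices; otherwise [KP] prevents a single
   line from containing all points. *)
have [PK|KP] := leqP #|P| K; first by lia.
suff : (#|P| <= r ^ 2)%N by lia.
have PP (p : 'I_y.+1) : p \in P -> prime p /\ (w < p)%N /\ ~~ (p %| c)%Z.
  by rewrite inE => /and3P[].
have dvd_diff (p : 'I_y.+1) (i j : nat) : p \in P -> (p %| b + i%:Z * c)%Z ->
    (p %| b + j%:Z * c)%Z -> (p %| i%:Z - j%:Z)%Z.
  move=> /PP[pp [_ pc]] pi pj.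
  have : (p %| (i%:Z - j%:Z) * c)%Z.
    have -> : (i%:Z - j%:Z) * c = (b + i%:Z * c) - (b + j%:Z * c) by ring.
    exact: rpredB.
  by rewrite !dvdzE abszM Euclid_dvdM// -!dvdzE (negbTE pc) orbF.
apply: (@linear_space_card_le _ 'I_L
          (fun (p : 'I_y.+1) (i : 'I_L) => (p %| b + i%:Z * c)%Z)).
(* Joining: [p * q <= y * y <= n] divides some term; when [p = q], use [p] itself. *)
- move=> p q Pp Pq; have [pp [wp _]] := PP p Pp; have [pq [wq _]] := PP q Pq.
  have [<-|neq] := eqVneq p q.
    have [|i iL pi] := divs p; first by rewrite prime_gt0 ?le_n.
    by exists (Ordinal iL); rewrite /= pi.
  have cop : coprime p q by rewrite prime_coprime// dvdn_prime2.
  have [|i iL pqi] := divs (p * q)%N.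
    rewrite muln_gt0 !prime_gt0//=; apply: leq_trans yn.
    by apply: leq_mul; rewrite -ltnS.
  exists (Ordinal iL) => /=.
  by move: pqi; rewrite !dvdzE /= Gauss_dvd.
(* Two common points would make [p * q > w * w >= L] divide the nonzero [i - j], which is smaller
   than [L] in absolute value. *)
- move=> i j neq p q Pp Pq pi qi pj qj; apply/eqP/negPn/negP => npq.
  have [pp [wp _]] := PP p Pp; have [pq [wq _]] := PP q Pq.
  have cop : coprime p q by rewrite prime_coprime// dvdn_prime2.
  have : (p * q %| absz (i%:Z - j%:Z)%R)%N.
    rewrite Gauss_dvd//; apply/andP; split.
      by have := dvd_diff p i j Pp pi pj; rewrite dvdzE.
    by have := dvd_diff q i j Pq qi qj; rewrite dvdzE.
  move/dvdn_leq; have := ltn_ord i; have := ltn_ord j; have := ltn_mul wp wq.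
  move: neq; rewrite -val_eqE /=; lia.
(* Indices on [p] are congruent modulo [p], hence determined by [i %/ p], which is below [r] because
   [L <= r * w <= r * p]. *)
- move=> p Pp; have [pp [wp _]] := PP p Pp.
  have lt_r (i : 'I_L) : (i %/ p < r)%N.
    rewrite ltn_divLR ?prime_gt0//; apply: leq_trans (ltn_ord i) _.
    by apply: leq_trans Lrw _; rewrite leq_mul2l ltnW ?orbT.
  rewrite -[leqRHS]card_ord -(card_in_imset (f := fun i => Ordinal (lt_r i))).
    exact: max_card.
  move=> i j /[!inE] pi pj [] ij; apply: val_inj => /=.
  rewrite (divn_eq i p) (divn_eq j p) ij; congr addn.
  have := dvd_diff p i j Pp pi pj.
  rewrite -eqz_mod_dvd !modz_nat => /eqP[]; exact.
- move=> i; apply/exists_inP; apply: contraTT KP.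
  rewrite negb_exists_in -leqNgt => /forall_inP hP.
  apply: (le_K _ i) => // p Pp; have [-> _] := PP p Pp.
  by have := hP p Pp; rewrite negbK.
Qed.

(** * Asymptotic count of the primes up to sqrt n *)

Lemma ln2_ge_half (R : realType) : 2^-1 <= ln 2 :> R.
Proof.
rewrite -ler_expR lnK ?posrE//.
have := expR_ge1Dx (- 2^-1 : R); rewrite expRN => h.
have := expR_gt0 (2^-1 : R) => e0.
have := ler_wpM2r (ltW e0) h; rewrite mulVf ?gt_eqF//; lra.
Qed.

(** This is ln z <= z - 1 taken at the [e]-th power of [n]. *)
Lemma ln_natr_le (R : realType) (n : nat) (e : R) : (0 < n)%N -> 0 < e ->
  ln n%:R <= e^-1 * n%:R `^ e.
Proof.
move=> n0 e0; have x0 : 0 < n%:R :> R by rewrite ltr0n.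
rewrite -(ler_pM2l e0) mulrA mulfV ?gt_eqF// mul1r -ln_powR.
have := powR_gt0 e x0; set z := _ `^ _ => z0.
have := le_ln1Dx (x := z - 1); have -> : 1 + (z - 1) = z by ring.
lra.
Qed.

(** Chebyshev's bound loses only a logarithm, which the power [e / 2] of [n] absorbs; another power
    [e / 2] is left to beat the constant. *)
Lemma eventually_lt_card_primes_sqrt (R : realType) (C e : R) :
  0 < C -> 0 < e -> exists N : nat, forall n, (N <= n)%N ->
    C * n%:R `^ (1 / 2 - e) <
      #|[set p : 'I_(Num.truncn (Num.sqrt n%:R : R)).+1 | prime p]|%:R.
Proof.
(* The 16 gives sqrt n >= 4, whence [y./2] is at least a quarter of sqrt n; the other threshold
   refutes the final bound [z <= 16 * C / e]. *)
move=> C0 e0; exists (maxn 16 (Num.truncn ((16 * C / e) `^ (2 / e))).+1) => n.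
rewrite geq_max => /andP[n16 nN]; rewrite ltNge; apply/negP => count_le.
have n0 : (0 < n)%N by rewrite (leq_trans _ n16).
have ln_le := ln_natr_le n0 (divr_gt0 e0 (ltr0n R 2)).
have x16 : 16 <= n%:R :> R by rewrite ler_nat.
have xN : (16 * C / e) `^ (2 / e) < n%:R.
  by apply: lt_le_trans (truncnS_gt _) _; rewrite ler_nat.
move: (n%:R : R) x16 xN ln_le count_le => x x16 xN ln_le count_le {n n0 n16 nN}.
have x0 : 0 < x by lra.
have sqrt_ge0 := sqrtr_ge0 x.
have sqrt_sqr : Num.sqrt x ^+ 2 = x by rewrite sqr_sqrtr ?ltW.
have sqrt_ge4 : 4 <= Num.sqrt x by nra.
move: count_le; have := truncn_itv sqrt_ge0; set y := Num.truncn _.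
move=> /andP[y_le y_gt]; set P := #|_| => count_le.
have y2 : (1 < y)%N by rewrite truncn_gt_nat; lra.
have y1 : 1 <= y%:R :> R by rewrite ler1n ltnW.
have half2 : (y./2.*2 <= y)%N by rewrite -[leqRHS]odd_double_half leq_addl.
have half_ge : Num.sqrt x / 4 <= (y./2)%:R.
  have : y%:R <= 1 + 2 * (y./2)%:R :> R.
    rewrite -natrM nat1r ler_nat mul2n -[leqLHS]odd_double_half -add1n.
    by rewrite leq_add2r leq_b1.
  by move: y_gt; rewrite -addn1 natrD; lra.
have := @expn2_le_expn_primes y y./2.
rewrite half_gt0 y2 half2 -/P => /(_ isT isT).
rewrite -(ler_nat R) !natrX -ler_ln ?posrE ?exprn_gt0//; last by lra.
rewrite !lnXn//; last by lra.
rewrite -[leLHS]mulr_natl -[leRHS]mulr_natl => key.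
set z := x `^ (e / 2) in ln_le; set s := x `^ (1 / 2 - e) in count_le.
have powD p q : x `^ p * x `^ q = x `^ (p + q).
  by rewrite powRD//; apply/implyP => _; exact: lt0r_neq0.
have szz : s * (z * z) = Num.sqrt x.
  by rewrite !powD -powR12_sqrt ?ltW//; congr (_ `^ _); lra.
have z0 : 0 < z by exact: powR_gt0.
have s0 : 0 < s by exact: powR_gt0.
have lny : ln y%:R <= (e / 2)^-1 * z.
  apply: le_trans ln_le; rewrite ler_ln ?posrE//; last by lra.
  by rewrite (le_trans y_le)// -[leRHS]sqrt_sqr expr2 ler_peMr//; lra.
(* Chebyshev's inequality in logarithmic form; as sqrt x is [s * (z * z)], cancelling [s * z] will
   bound [z]. *)
have ineq : Num.sqrt x / 4 * 2^-1 <= C * s * ((e / 2)^-1 * z).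
  apply: le_trans (_ : (y./2)%:R * ln 2 <= _).
    by apply: ler_pM => //; exact: ln2_ge_half.
  by apply: le_trans key _; apply: ler_pM => //; rewrite ln_ge0.
have z_le : z <= 16 * C / e.
  rewrite -(ler_pM2l (mulr_gt0 s0 z0)) -mulrA szz.
  have -> : s * z * (16 * C / e) = 8 * (C * s * ((e / 2)^-1 * z)).
    by field; rewrite gt_eqF.
  lra.
suff : x <= (16 * C / e) `^ (2 / e) by lra.
have -> : x = z `^ (2 / e).
  rewrite /z -powRrM (_ : e / 2 * (2 / e) = 1) ?powRr1 ?ltW//.
  by field; rewrite gt_eqF.
by rewrite ge0_ler_powR// ?nnegrE ?divr_ge0 ?mulr_ge0// ltW.
Qed.

(** * Choice of the parameters *)

Lemma progression_no_divisor_property (R : realType) (e : R) :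
  0 < e -> e <= 1 / 4 ->
  exists N : nat, forall n, (N <= n)%N -> forall (b c : int) (L : nat),
    (0 < L)%N ->
    (forall i, (i < L)%N -> 0 < b + i%:Z * c /\
      (b + i%:Z * c)%:~R <= expR (n%:R `^ (1 / 2 - e) : R)) ->
    L%:R <= n%:R `^ (3 / 4 - 2 * e) :> R ->
    ~ (forall d, (1 <= d <= n)%N ->
         exists2 i, (i < L)%N & (d %| b + i%:Z * c)%Z).
Proof.
move=> e0 e4.
(* For the 12: below, [w <= s + 1], [K <= 2 * s + 1] and [r ^ 2 <= 4 * s], so
   [w + K.*2 + r ^ 2 <= 9 * s + 3 <= 12 * s]. *)
have [N hN] := eventually_lt_card_primes_sqrt (ltr0n R 12) e0.
exists (maxn 1 N) => n; rewrite geq_max => /andP[n1 /hN lt_count].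
move=> b c L L0 small hL divs.
have x1 : 1 <= n%:R :> R by rewrite ler1n.
have powD p q : n%:R `^ p * n%:R `^ q = n%:R `^ (p + q) :> R.
  by rewrite powRD//; apply/implyP => _; rewrite lt0r_neq0// ltr0n.
have pow_ge1 (p : R) : 0 <= p -> 1 <= n%:R `^ p.
  by move=> p0; have := ler_powR x1 p0; rewrite powRr0.
have sqrt_ge0 := sqrtr_ge0 (n%:R : R).
have yn : (Num.truncn (Num.sqrt n%:R : R) *
           Num.truncn (Num.sqrt n%:R : R) <= n)%N.
  rewrite -(ler_nat R) natrM -[leRHS]sqr_sqrtr// expr2.
  by apply: ler_pM; rewrite ?truncn_le.
move: yn lt_count small; set y := Num.truncn _; set s := _ `^ _.
move=> yn lt_count small.
(* [w] and [r] will be [s] and [t] rounded up: [t * s] is exactly the allowed length, while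
   [t * t <= s] keeps [r ^ 2] of order [s]. *)
pose t : R := n%:R `^ (1 / 4 - e).
have s1 : 1 <= s by apply: pow_ge1; lra.
have t1 : 1 <= t by apply: pow_ge1; lra.
have tt : t * t <= s by rewrite powD ler_powR//; lra.
have ss : L%:R <= s * s by apply: le_trans hL _; rewrite powD ler_powR//; lra.
have ts : L%:R <= t * s by apply: le_trans hL _; rewrite powD ler_powR//; lra.
move: s t s1 t1 tt ss ts lt_count small => s t s1 t1 tt ss ts lt_count small.
have truncS (z : R) : 1 <= z -> exists2 m : nat, z < m%:R & m%:R <= z + 1.
  move=> z1; exists (Num.truncn z).+1; first exact: truncnS_gt.
  by rewrite -addn1 natrD lerD2r truncn_le; lra.
have [w w_gt w_le] := truncS s s1.
have [r r_gt r_le] := truncS t t1.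
(* The factor 2 compensates for [ln 2 >= 2^-1], so that [2 ^ K] exceeds [expR s]. *)
have [K K_gt K_le] : exists2 m : nat, 2 * s < m%:R & m%:R <= 2 * s + 1.
  by apply: truncS; lra.
have Lww : (L <= w * w)%N.
  by rewrite -(ler_nat R) natrM (le_trans ss)// ler_pM//; lra.
have Lrw : (L <= r * w)%N.
  by rewrite -(ler_nat R) natrM (le_trans ts)// ler_pM//; lra.
have small' i : (i < L)%N -> 0 < b + i%:Z * c /\
    (absz (b + i%:Z * c)%R < 2 ^ K.+1)%N.
  move=> iL; have [a0 aH] := small i iL; split=> //.
  rewrite -(ltr_nat R) natr_absz gtr0_norm// natrX.
  apply: le_lt_trans aH _.
  rewrite -[ltRHS](@lnK R) ?posrE ?exprn_gt0// ltr_expR lnXn//.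
  rewrite -[ltRHS]mulr_natl; apply: (@lt_le_trans _ _ (K%:R * 2^-1)).
    by lra.
  by apply: ler_pM; rewrite ?ler_nat ?invr_ge0//; exact: ln2_ge_half.
have := card_primes_le_of_divisor_progression yn L0 Lww Lrw small' divs.
apply/negP; rewrite -ltnNge -(ltr_nat R) (le_lt_trans _ lt_count)//.
have rr : r%:R * r%:R <= (2 * t) * (2 * t) by apply: ler_pM => //; lra.
rewrite -muln2 !natrD natrM natrX expr2; lra.
Qed.

(** * From indexed terms to sets, and the theorem *)

Lemma le_fset_max (A : {fset int}) (a : int) : a \in A -> a <= fset_max A.
Proof. by move=> aA; exact: (@le_bigmax_seq _ _ _ _ 0 a xpredT id). Qed.

Lemma eventually_no_divisor_progression (R : realType) (e : R) :
  0 < e -> e <= 1 / 4 ->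
  exists N : nat, forall n, (N <= n)%N -> forall (b c : int) (L : nat),
    (0 < L)%N -> positive_fset (arith_prog b c L) ->
    divisor_property n (arith_prog b c L) ->
    L%:R <= n%:R `^ (3 / 4 - 2 * e) :> R ->
    (fset_max (arith_prog b c L))%:~R <= expR (n%:R `^ (1 / 2 - e)) :> R ->
    False.
Proof.
move=> e0 e4; have [N hN] := progression_no_divisor_property e0 e4.
exists N => n Nn b c L L0 pos divs hL hH.
have mem i : (i < L)%N -> b + i%:Z * c \in arith_prog b c L.
  by move=> iL; rewrite inE; apply/mapP; exists i; rewrite // mem_iota.
apply: (hN n Nn b c L L0 _ hL) => [i iL|d dn].
  split; first exact/pos/mem.
  by apply: le_trans hH; rewrite ler_int le_fset_max ?mem.
have [a + da] := divs d dn; rewrite inE => /mapP[i].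
by rewrite mem_iota => iL ai; exists i; rewrite // -ai.
Qed.

Local Open Scope classical_set_scope.

Theorem corollary1p2 (R : realType) (alpha beta : R)
    (alpha_ge0 : 0 <= alpha) (beta_ge0 : 0 <= beta)
    (alpha_lt : alpha < 1 / 2) (beta_lt : beta < 3 / 8) :
  (~ exists (u : nat -> nat) (eps1 eps2 : nat -> R),
      (forall k : nat, (0 < u k)%N) /\
      u k @[k --> \oo] --> \oo /\
      eps1 (u k) @[k --> \oo] --> (0 : R) /\
      eps2 (u k) @[k --> \oo] --> (0 : R) /\
      (forall k : nat, exists (b c : int) (L : nat),
        (0 < L)%N /\
        positive_fset (arith_prog b c L) /\
        divisor_property (u k) (arith_prog b c L) /\
        L%:R <= (u k)%:R `^ (2 * beta + eps1 (u k)) /\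
        (fset_max (arith_prog b c L))%:~R
          <= expR ((u k)%:R `^ (alpha + eps2 (u k))))) /\
  (\forall n \near \oo, ~ exists (b c : int) (L : nat),
      (0 < L)%N /\
      positive_fset (arith_prog b c L) /\
      divisor_property n (arith_prog b c L) /\
      L%:R <= n%:R `^ (2 * beta) /\
      (fset_max (arith_prog b c L))%:~R <= expR (n%:R `^ alpha)).
Proof.
(* Chosen so that [2 * beta + e <= 3 / 4 - 2 * e] and [alpha + e <= 1 / 2 - e]: an error of [e] in
   either exponent is affordable. *)
pose e := Num.min (1 / 4)
  (Num.min ((3 / 4 - 2 * beta) / 3) ((1 / 2 - alpha) / 2)).
have e0 : 0 < e by rewrite !lt_min; apply/and3P; split; lra.
have [e4 [eb ea]] : e <= 1 / 4 /\ e <= (3 / 4 - 2 * beta) / 3 /\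
    e <= (1 / 2 - alpha) / 2.
  by rewrite /e !ge_min !lexx !orbT.
have [N hN] := eventually_no_divisor_progression e0 e4.
(* Serves both claims: [p] and [q] are the o(1) terms in the first and 0 in the second. The lower
   bound 1 on [n] makes its powers monotone in the exponent. *)
have contra n (p q : R) b c L : (maxn 1 N <= n)%N -> p <= e -> q <= e ->
    (0 < L)%N -> positive_fset (arith_prog b c L) ->
    divisor_property n (arith_prog b c L) ->
    L%:R <= n%:R `^ (2 * beta + p) ->
    (fset_max (arith_prog b c L))%:~R <= expR (n%:R `^ (alpha + q)) -> False.
  rewrite geq_max => /andP[n1 Nn] pe qe L0 pos divs hL hH.
  apply: (hN n Nn b c L L0 pos divs).
    by apply: le_trans hL _; rewrite ler_powR ?ler1n//; lra.
  by apply: le_trans hH _; rewrite ler_expR ler_powR ?ler1n//; lra.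
split.
  move=> [u [eps1 [eps2 [_ [u_oo [eps1_0 [eps2_0 hu]]]]]]].
  have /cvgnyPge/(_ (maxn 1 N)) u_ge := u_oo.
  have eps1_le : \forall k \near \oo, eps1 (u k) <= e.
    exact: (cvgr_le _ eps1_0 _ e0).
  have eps2_le : \forall k \near \oo, eps2 (u k) <= e.
    exact: (cvgr_le _ eps2_0 _ e0).
  have [k [[uk e1k] e2k]] := filter_ex (filterI (filterI u_ge eps1_le) eps2_le).
  have [b [c [L [L0 [pos [divs [hL hH]]]]]]] := hu k.
  exact: (contra (u k) _ _ b c L uk e1k e2k L0 pos divs hL hH).
exists (maxn 1 N) => // n /= Nn [b [c [L [L0 [pos [divs [hL hH]]]]]]].
apply: (contra n 0 0 b c L Nn _ _ L0 pos divs); rewrite ?addr0//; exact: ltW.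
Qed.
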